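(* Let $C>1$ and $r,\ell>1$ with $(800C^4)^2r^{1/3}<\ell<r^{2/3}$. Let $w\in(0,1)$ and suppose $|w-a/q|\le \ell/(25r)$ for some irreducible rational $a/q$ with $1\le q<800C^4r^{2/3}/\ell$. Then there exists a curve $\Gamma\subset\mathbb R^2$ such that (i) $\Gamma$ is twice differentiable and its radius of curvature always lies in $[r/16,16r]$; (ii) the length of $\Gamma$ is less than $\ell$; (iii) the initial slope of $\Gamma$ is $w$; (iv) $|\Gamma\cap\mathbb Z^2|\ge \frac14+\frac14\,\frac{1}{(800C^4)^6}\,\frac{q\ell^2}{r}$. *)

(* Defs.v *)
From Stdlib Require Import Reals ZArith List.
From Coquelicot Require Import Coquelicot.
Open Scope R_scope.

(* The coordinates are total functions, but only their restriction to
   [[t_start, t_end]] is the curve. *)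
Record plane_curve := PlaneCurve {
  t_start : R;
  t_end : R;
  cx : R -> R;
  cy : R -> R;
  t_start_lt_end : t_start < t_end
}.

Definition domain (G : plane_curve) (t : R) : Prop := t_start G <= t <= t_end G.

Definition trace (G : plane_curve) (p : R * R) : Prop :=
  exists t : R, domain G t /\ p = (cx G t, cy G t).

(* Derivatives at the two end points are two-sided.  This is no restriction:
   a function that is twice differentiable on a closed interval, with one-sided
   derivatives at the end points, extends to R by its second-order Taylor
   polynomials there. *)
Definition twice_differentiable (f : R -> R) (t : R) : Prop :=
  ex_derive f t /\ ex_derive (Derive f) t.

Definition speed (G : plane_curve) (t : R) : R :=
  sqrt (Derive (cx G) t ^ 2 + Derive (cy G) t ^ 2).

(* The parametrization must be regular: without it, smoothness of the
   coordinates says nothing about the curve. *)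
Definition twice_differentiable_curve (G : plane_curve) : Prop :=
  forall t : R, domain G t ->
    twice_differentiable (cx G) t /\ twice_differentiable (cy G) t /\
    speed G t <> 0.

Definition curvature (G : plane_curve) (t : R) : R :=
  (Derive (cx G) t * Derive (Derive (cy G)) t
   - Derive (cy G) t * Derive (Derive (cx G)) t) / speed G t ^ 3.

Definition radius_of_curvature (G : plane_curve) (t : R) : R :=
  / Rabs (curvature G t).

(* Where the curvature vanishes the radius is infinite, hence in no bounded
   interval; this case is excluded explicitly since [/ 0] is a real number. *)
Definition radius_of_curvature_in (G : plane_curve) (lo hi : R) : Prop :=
  forall t : R, domain G t ->
    curvature G t <> 0 /\ lo <= radius_of_curvature G t <= hi.

(* For a twice differentiable curve the speed is continuous on the domain, so
   this integral exists. *)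
Definition curve_length (G : plane_curve) : R :=
  RInt (speed G) (t_start G) (t_end G).

Definition initial_slope (G : plane_curve) (w : R) : Prop :=
  Derive (cx G) (t_start G) <> 0 /\
  Derive (cy G) (t_start G) / Derive (cx G) (t_start G) = w.

Definition lattice_points_on (G : plane_curve) (p : Z * Z) : Prop :=
  trace G (IZR (fst p), IZR (snd p)).

Definition has_cardinal {T : Type} (A : T -> Prop) (n : nat) : Prop :=
  exists s : list T,
    NoDup s /\ (forall x : T, In x s <-> A x) /\ length s = n.

(* Main.v *)
(** In the coordinates X = x, H = q y - a x, a curve of curvature about 1/r whose
    tangent is nearly parallel to (q, a) looks like the parabola H = q X^2 / (2 r),
    so on a length l it crosses about q l^2 / r of the lines q y - a x = const,
    on each of which the lattice points are q apart. One can follow lattice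
    points exactly: fix an integer k about M^2, where M = 800 C^4, and an integer
    vector u = (b, d) with q d - a b = k. The points j u - e j (j - 1) (q, a) all
    lie on one parabola, with increments of the abscissa constant up to a factor
    2. Its curvature is about 2 k e / s^3 with s = b + e q, and a positive
    integer e making this about 1/r exists because (q l)^3 < M^3 r^2. The
    parabola is nowhere parallel to (q, a), so to reach the initial slope w the
    arc is prolonged to the left by its second-order Taylor polynomial, whose
    slope is affine. *)
Require Import Defs.
From Stdlib Require Import Reals ZArith List Lia Lra ClassicalEpsilon FinFun.
From Coquelicot Require Import Coquelicot.
Open Scope R_scope.

(** * Gluing two functions at 0 *)

Definition glue (g h : R -> R) (x : R) : R := if Rle_dec x 0 then g x else h x.

Lemma glue_le (g h : R -> R) (x : R) : x <= 0 -> glue g h x = g x.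
Proof. intros hx; unfold glue; destruct (Rle_dec x 0); [reflexivity | lra]. Qed.

Lemma glue_ge (g h : R -> R) (x : R) : g 0 = h 0 -> 0 <= x -> glue g h x = h x.
Proof.
intros h0 hx; unfold glue; destruct (Rle_dec x 0); [ | reflexivity].
now replace x with 0 by lra.
Qed.

(** Only 0 is delicate: there both difference quotients tend to the same limit, so the smaller of
    the two radii serves. Applied to a function and then to its derivative, this gives two
    derivatives across the junction. *)
Lemma is_derive_glue (g h g1 h1 : R -> R) (B x : R) :
  0 < B ->
  (forall y, y <= 0 -> is_derive g y (g1 y)) ->
  (forall y, 0 <= y < B -> is_derive h y (h1 y)) ->
  g 0 = h 0 -> g1 0 = h1 0 ->
  x < B -> is_derive (glue g h) x (glue g1 h1 x).
Proof.
intros hB dg dh h0 h10 hx.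
destruct (Rtotal_order x 0) as [xneg | [x0 | xpos]].
- rewrite glue_le by lra.
  apply (is_derive_ext_loc g); [ | apply dg; lra].
  assert (hd : 0 < - x) by lra.
  exists (mkposreal _ hd); intros y hy.
  change (Rabs (y - x) < - x) in hy.
  apply Rabs_def2 in hy; rewrite glue_le; [reflexivity | lra].
- subst x; rewrite glue_le by lra.
  apply is_derive_Reals; intros eps heps.
  assert (dg0 := dg 0 (Rle_refl 0)).
  assert (dh0 := dh 0 (conj (Rle_refl 0) hB)).
  apply is_derive_Reals in dg0; apply is_derive_Reals in dh0.
  destruct (dg0 eps heps) as [d1 hd1]; destruct (dh0 eps heps) as [d2 hd2].
  assert (hd : 0 < Rmin d1 d2) by (apply Rmin_pos; apply cond_pos).
  exists (mkposreal _ hd); intros t tne ht; simpl in ht.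
  rewrite (glue_le g h 0) by lra.
  destruct (Rle_dec t 0).
  + rewrite glue_le by lra.
    apply hd1; [assumption | apply Rlt_le_trans with (1 := ht), Rmin_l].
  + rewrite glue_ge, h0, h10 by lra.
    apply hd2; [assumption | apply Rlt_le_trans with (1 := ht), Rmin_r].
- rewrite glue_ge by lra.
  apply (is_derive_ext_loc h); [ | apply dh; lra].
  exists (mkposreal _ xpos); intros y hy.
  change (Rabs (y - x) < x) in hy.
  apply Rabs_def2 in hy; rewrite glue_ge; [reflexivity | assumption | lra].
Qed.

(** * Regularity, curvature and length of a graph *)

Definition graph_curve (x0 x1 : R) (f : R -> R) (h : x0 < x1) : plane_curve :=
  PlaneCurve x0 x1 (fun x => x) f h.

(** The open half-line provides two-sided derivatives at both ends of an interval [[x0, x1]] with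
    [x1 < B]. *)
Definition twice_derivatives (f f1 f2 : R -> R) (B : R) : Prop :=
  forall x, x < B -> is_derive f x (f1 x) /\ is_derive f1 x (f2 x).

(** A second derivative depends on the first one near [x], hence an equality on a neighbourhood. *)
Lemma Derive_loc (f f1 f2 : R -> R) (B x : R) :
  twice_derivatives f f1 f2 B -> x < B -> locally x (fun y => f1 y = Derive f y).
Proof.
intros df hx.
assert (hd : 0 < B - x) by lra.
exists (mkposreal _ hd); intros y hy.
change (Rabs (y - x) < B - x) in hy; apply Rabs_def2 in hy.
symmetry; apply is_derive_unique, df; lra.
Qed.

Lemma is_derive_Derive (f f1 f2 : R -> R) (B x : R) :
  twice_derivatives f f1 f2 B -> x < B -> is_derive (Derive f) x (f2 x).
Proof.
intros df hx.
apply (is_derive_ext_loc f1); [now apply (Derive_loc f f1 f2 B) | now apply df].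
Qed.

Lemma Derive_Derive_id (x : R) : Derive (Derive (fun x : R => x)) x = 0.
Proof.
rewrite (Derive_ext _ (fun _ => 1)); [apply Derive_const | apply Derive_id].
Qed.

Section Graph.

Variables (f f1 f2 : R -> R) (B x0 x1 : R) (x01 : x0 < x1).
Hypothesis df : twice_derivatives f f1 f2 B.
Hypothesis x1B : x1 < B.

Let G := graph_curve x0 x1 f x01.

Lemma speed_graph (x : R) : x < B -> speed G x = sqrt (1 + f1 x ^ 2).
Proof using df.
intros hx; unfold speed; simpl cx; simpl cy.
rewrite Derive_id, (is_derive_unique f x (f1 x)) by now apply df.
f_equal; ring.
Qed.

Lemma speed_graph_pos (x : R) : x < B -> 0 < speed G x.
Proof using df.
intros hx; rewrite speed_graph by assumption.
apply sqrt_lt_R0; assert (0 <= f1 x ^ 2) by apply pow2_ge_0; lra.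
Qed.

Lemma twice_differentiable_graph : twice_differentiable_curve G.
Proof using df x1B.
intros x [_ hx]; simpl in hx.
assert (xB : x < B) by lra.
split; [ | split].
- split; [exists 1; apply (is_derive_id x) | ].
  exists 0; apply (is_derive_ext (fun _ => 1)); [intros t; now rewrite Derive_id | ].
  apply (is_derive_const 1 x).
- split; [exists (f1 x); now apply df | exists (f2 x)].
  now apply (is_derive_Derive f f1 f2 B).
- assert (h := speed_graph_pos x xB); lra.
Qed.

Lemma curvature_graph (x : R) : x < B -> curvature G x = f2 x / speed G x ^ 3.
Proof using df.
intros hx; unfold curvature; simpl cx; simpl cy.
rewrite Derive_id, Derive_Derive_id.
rewrite (is_derive_unique (Derive f) x (f2 x))
  by now apply (is_derive_Derive f f1 f2 B).
f_equal; ring.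
Qed.

Lemma initial_slope_graph : initial_slope G (f1 x0).
Proof using df x1B.
unfold initial_slope; simpl.
rewrite Derive_id, (is_derive_unique f x0 (f1 x0)) by (apply df; lra).
split; lra.
Qed.

Lemma speed_graph_bounds (K x : R) :
  0 < K -> f1 x ^ 2 <= K ^ 2 - 1 -> x < B -> 1 <= speed G x <= K.
Proof using df.
intros hK hf hx; rewrite speed_graph by assumption.
assert (0 <= f1 x ^ 2) by apply pow2_ge_0.
split.
- rewrite <- sqrt_1 at 1; apply sqrt_le_1_alt; lra.
- rewrite <- (sqrt_pow2 K) by lra; apply sqrt_le_1_alt; lra.
Qed.

(** The radius is [v ^ 3 / f2 x], where the speed [v] lies between 1 and [K]. *)
Lemma radius_of_curvature_graph (K lo hi : R) :
  0 < K -> 0 < lo -> 0 < hi ->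
  (forall x, x0 <= x <= x1 -> f1 x ^ 2 <= K ^ 2 - 1) ->
  (forall x, x0 <= x <= x1 -> K ^ 3 / hi <= f2 x <= / lo) ->
  radius_of_curvature_in G lo hi.
Proof using df x1B.
intros hK hlo hhi b1 b2 x hx; unfold Defs.domain in hx; simpl in hx.
assert (xB : x < B) by lra.
unfold radius_of_curvature; rewrite curvature_graph by assumption.
destruct (speed_graph_bounds K x hK (b1 x hx) xB) as [s1 sK].
destruct (b2 x hx) as [f2lo f2hi].
set (v := speed G x) in *; set (c := f2 x) in *.
assert (hv : 1 <= v ^ 3) by (apply pow_R1_Rle; lra).
assert (hvK : v ^ 3 <= K ^ 3) by (apply pow_incr; lra).
assert (hKhi : 0 < K ^ 3 / hi) by (apply Rdiv_lt_0_compat; [apply pow_lt | ]; lra).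
assert (hpos : 0 < c / v ^ 3) by (apply Rdiv_lt_0_compat; lra).
split; [lra | ].
rewrite Rabs_pos_eq by lra.
replace (/ (c / v ^ 3)) with (v ^ 3 / c) by (field; lra).
assert (hloc : lo * c <= 1).
{ apply (Rmult_le_compat_l lo) in f2hi; [ | lra].
  now rewrite Rinv_r in f2hi by lra. }
assert (hhic : K ^ 3 <= hi * c).
{ apply (Rmult_le_compat_l hi) in f2lo; [ | lra].
  replace (hi * (K ^ 3 / hi)) with (K ^ 3) in f2lo by (field; lra); assumption. }
split.
- apply Rmult_le_reg_r with c; [lra | ].
  replace (v ^ 3 / c * c) with (v ^ 3) by (field; lra); lra.
- apply Rmult_le_reg_r with c; [lra | ].
  replace (v ^ 3 / c * c) with (v ^ 3) by (field; lra); lra.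
Qed.

Lemma curve_length_graph (K : R) :
  0 < K -> (forall x, x0 <= x <= x1 -> f1 x ^ 2 <= K ^ 2 - 1) ->
  curve_length G <= K * (x1 - x0).
Proof using df x1B.
intros hK b1; unfold curve_length; simpl t_start; simpl t_end.
replace (K * (x1 - x0)) with (RInt (fun _ => K) x0 x1)
  by (rewrite RInt_const; unfold scal; simpl; unfold mult; simpl; ring).
apply RInt_le; [lra | | apply ex_RInt_const | ].
- apply (ex_RInt_ext (fun x => sqrt (1 + f1 x ^ 2))).
  + rewrite Rmax_right by lra; intros x hx.
    symmetry; apply speed_graph; lra.
  + apply (ex_RInt_continuous (V := R_CompleteNormedModule)).
    rewrite Rmax_right by lra; intros x hx.
    assert (0 <= f1 x ^ 2) by apply pow2_ge_0.
    apply (ex_derive_continuous (V := R_NormedModule)).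
    assert (ex_derive f1 x) by (exists (f2 x); apply df; lra).
    auto_derive; simpl in *; repeat split; auto; lra.
- intros x hx; apply speed_graph_bounds; [assumption | apply b1; lra | lra].
Qed.

End Graph.

(** * Counting the lattice points of a graph *)

Lemma has_cardinal_of_finite (T : Type) (A : T -> Prop) (L : list T) :
  (forall x, A x -> In x L) -> exists n, has_cardinal A n.
Proof.
intros AL.
pose (deq := fun x y : T => excluded_middle_informative (x = y)).
pose (dA := fun x : T => if excluded_middle_informative (A x) then true else false).
exists (length (nodup deq (filter dA L))), (nodup deq (filter dA L)).
split; [apply NoDup_nodup | split; [ | reflexivity]].
intros x; rewrite nodup_In, filter_In; unfold dA.
destruct (excluded_middle_informative (A x)); intuition; discriminate.
Qed.

Lemma has_cardinal_ge (T : Type) (A : T -> Prop) (n N : nat) (g : nat -> T) :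
  Injective g -> (forall j, (j < n)%nat -> A (g j)) -> has_cardinal A N -> (n <= N)%nat.
Proof.
intros ginj gA [s [_ [hs <-]]].
rewrite <- (length_seq n 0), <- (length_map g).
apply NoDup_incl_length.
- now apply Injective_map_NoDup; [ | apply seq_NoDup].
- intros y hy; apply in_map_iff in hy as [j [<- hj]].
  apply in_seq in hj; apply hs, gA; lia.
Qed.

Lemma lattice_points_on_graph (x0 x1 : R) (f : R -> R) (h : x0 < x1) (x y : Z) :
  lattice_points_on (graph_curve x0 x1 f h) (x, y) <->
  x0 <= IZR x <= x1 /\ IZR y = f (IZR x).
Proof.
unfold lattice_points_on, trace, Defs.domain; simpl; split.
- now intros [t [ht [= -> ->]]].
- intros [hx ->]; now exists (IZR x).
Qed.

Lemma Int_part_IZR (z : Z) : Int_part (IZR z) = z.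
Proof. symmetry; apply Int_part_spec; lra. Qed.

Lemma lattice_points_on_graph_finite (x0 x1 : R) (f : R -> R) (h : x0 < x1) :
  exists n, has_cardinal (lattice_points_on (graph_curve x0 x1 f h)) n.
Proof.
pose (lo := Int_part x0); pose (len := Z.to_nat (up x1 - lo)).
(* Each abscissa carries at most one point. If [f] is not an integer there, the candidate is
   spurious, which is harmless in a mere superset. *)
pose (pt := fun i => let x := (lo + Z.of_nat i)%Z in (x, Int_part (f (IZR x)))).
apply (has_cardinal_of_finite _ _ (map pt (seq 0 len))).
intros [x y] hxy; apply lattice_points_on_graph in hxy as [[hx0 hx1] hy].
assert (lo <= x)%Z.
{ apply le_IZR; destruct (base_Int_part x0); fold lo in H; lra. }
assert (x < up x1)%Z.
{ apply lt_IZR; destruct (archimed x1); lra. }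
apply in_map_iff; exists (Z.to_nat (x - lo)); split.
- unfold pt; rewrite Z2Nat.id by lia; replace (lo + (x - lo))%Z with x by ring.
  now rewrite <- hy, Int_part_IZR.
- apply in_seq; unfold len; lia.
Qed.

(** * The parabolic arc and its prolongation to the left *)

(* In the coordinates where the direction (q, a) is horizontal, [arc s p h] is
   the graph traced by t |-> (s t - p t^2, h t), and [arc_left s p h] is its
   second-order Taylor polynomial at 0. *)
Definition arc_root (s p x : R) : R := sqrt (s ^ 2 - 4 * p * x).
Definition arc (s p h x : R) : R := h * (s - arc_root s p x) / (2 * p).
Definition arc1 (s p h x : R) : R := h / arc_root s p x.
Definition arc2 (s p h x : R) : R := 2 * h * p / arc_root s p x ^ 3.

Definition arc_left (s p h x : R) : R := h / s * x + h * p / s ^ 3 * x ^ 2.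
Definition arc_left1 (s p h x : R) : R := h / s + 2 * h * p / s ^ 3 * x.
Definition arc_left2 (s p h x : R) : R := 2 * h * p / s ^ 3.

Section Arc.

Variables s p h al : R.
Hypotheses (s_pos : 0 < s) (p_pos : 0 < p) (h_pos : 0 < h).

(** The abscissa where [arc_root] vanishes and the parabola has a vertical tangent. *)
Let B := s ^ 2 / (4 * p).

Lemma arc_dom_pos (x : R) : x < B -> 0 < s ^ 2 - 4 * p * x.
Proof using p_pos.
unfold B; intros hx.
apply (Rmult_lt_compat_r (4 * p)) in hx; [ | lra].
replace (s ^ 2 / (4 * p) * (4 * p)) with (s ^ 2) in hx by (field; lra); lra.
Qed.

Lemma arc_root_pos (x : R) : x < B -> 0 < arc_root s p x.
Proof using p_pos. intros hx; now apply sqrt_lt_R0, arc_dom_pos. Qed.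

Lemma arc_root_0 : arc_root s p 0 = s.
Proof using s_pos.
unfold arc_root; replace (s ^ 2 - 4 * p * 0) with (s ^ 2) by ring.
apply sqrt_pow2; lra.
Qed.

Lemma is_derive_arc (x : R) : x < B -> is_derive (arc s p h) x (arc1 s p h x).
Proof using p_pos.
intros hx; assert (h1 := arc_dom_pos x hx); assert (h2 := arc_root_pos x hx).
unfold arc, arc1, arc_root in *; auto_derive.
- simpl in *; lra.
- unfold Rminus in *; simpl in *; field; lra.
Qed.

Lemma is_derive_arc1 (x : R) : x < B -> is_derive (arc1 s p h) x (arc2 s p h x).
Proof using p_pos.
intros hx; assert (h1 := arc_dom_pos x hx); assert (h2 := arc_root_pos x hx).
unfold arc1, arc2, arc_root in *; auto_derive.
- unfold Rminus in *; simpl in *; repeat split; lra.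
- unfold Rminus in *; simpl in *; field; lra.
Qed.

(** Adding [al * x], with [al] the slope [a / q], undoes the shear that made the direction (q, a)
    horizontal. *)
Definition osc : R -> R := fun x => al * x + glue (arc_left s p h) (arc s p h) x.
Definition osc1 : R -> R := fun x => al + glue (arc_left1 s p h) (arc1 s p h) x.
Definition osc2 : R -> R := glue (arc_left2 s p h) (arc2 s p h).

(** Since [arc_root] is [s] at 0, the two pieces agree there to second order. *)
Lemma twice_derivatives_osc : twice_derivatives osc osc1 osc2 B.
Proof using s_pos p_pos.
assert (hB : 0 < B).
{ apply Rdiv_lt_0_compat; [apply pow_lt | ]; lra. }
intros x hx; unfold osc, osc1, osc2; split.
- apply (is_derive_plus (V := R_NormedModule) (fun x => al * x)).
  { auto_derive; [trivial | ring]. }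
  apply (is_derive_glue _ _ _ _ B); try assumption.
  + intros y _; unfold arc_left, arc_left1; auto_derive; [trivial | field; lra].
  + intros y hy; now apply is_derive_arc.
  + unfold arc, arc_left; rewrite arc_root_0; field; lra.
  + unfold arc1, arc_left1; rewrite arc_root_0; field; lra.
- replace (glue (arc_left2 s p h) (arc2 s p h) x)
    with (plus 0 (glue (arc_left2 s p h) (arc2 s p h) x))
    by (unfold plus; simpl; ring).
  apply (is_derive_plus (V := R_NormedModule) (fun _ => al)).
  { apply (is_derive_const al x). }
  apply (is_derive_glue _ _ _ _ B); try assumption.
  + intros y _; unfold arc_left1, arc_left2; auto_derive; [trivial | field; lra].
  + intros y hy; now apply is_derive_arc1.
  + unfold arc1, arc_left1; rewrite arc_root_0; field; lra.
  + unfold arc2, arc_left2; rewrite arc_root_0; field; lra.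
Qed.

(* The abscissa where [arc_root] has decreased to [s / 2]. *)
Definition arc_end : R := 3 * s ^ 2 / (16 * p).

Lemma arc_end_pos : 0 < arc_end.
Proof using s_pos p_pos.
apply Rdiv_lt_0_compat; [ | lra]; assert (0 < s ^ 2) by (apply pow_lt; lra); lra.
Qed.

Lemma arc_end_lt : arc_end < B.
Proof using s_pos p_pos.
assert (e := arc_end_pos); unfold B.
replace (s ^ 2 / (4 * p)) with (4 / 3 * arc_end) by (unfold arc_end; field; lra); lra.
Qed.

Lemma arc_root_bounds (x : R) : 0 <= x <= arc_end -> s / 2 <= arc_root s p x <= s.
Proof using s_pos p_pos.
intros [hx0 hx1].
assert (hpx : 4 * p * x <= 3 / 4 * s ^ 2).
{ apply (Rmult_le_compat_l (4 * p)) in hx1; [ | lra].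
  replace (4 * p * arc_end) with (3 / 4 * s ^ 2) in hx1
    by (unfold arc_end; field; lra); lra. }
assert (0 <= p * x) by (apply Rmult_le_pos; lra).
unfold arc_root; split.
- rewrite <- (sqrt_pow2 (s / 2)) by lra; apply sqrt_le_1_alt; lra.
- rewrite <- (sqrt_pow2 s) at 2 by lra; apply sqrt_le_1_alt; lra.
Qed.

(** On the right the root lies between [s / 2] and [s], so the slope at most doubles; on the left
    the Taylor slope increases up to [h / s]. The lower bound on the left depends on where the curve
    starts, and is left to the caller. *)
Lemma osc1_bounds (w x : R) :
  w <= al + h / s -> (x < 0 -> w <= osc1 x) -> x <= arc_end ->
  w <= osc1 x <= al + 2 * (h / s).
Proof using s_pos p_pos h_pos.
intros hw hneg hx.
assert (hs : 0 < h / s) by (apply Rdiv_lt_0_compat; lra).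
destruct (Rlt_le_dec x 0) as [xneg | xpos].
- split; [auto | ]; unfold osc1; rewrite glue_le by lra; unfold arc_left1.
  assert (0 < 2 * h * p / s ^ 3).
  { apply Rdiv_lt_0_compat; [ | apply pow_lt; lra].
    repeat apply Rmult_lt_0_compat; lra. }
  nra.
- unfold osc1; rewrite glue_ge;
    [ | unfold arc1, arc_left1; rewrite arc_root_0; field; lra | assumption].
  destruct (arc_root_bounds x (conj xpos hx)) as [b1 b2]; unfold arc1.
  assert (h / s <= h / arc_root s p x).
  { apply Rmult_le_compat_l; [lra | apply Rinv_le_contravar; lra]. }
  assert (h / arc_root s p x <= h / (s / 2)).
  { apply Rmult_le_compat_l; [lra | apply Rinv_le_contravar; lra]. }
  replace (h / (s / 2)) with (2 * (h / s)) in * by (field; lra); lra.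
Qed.

(** The factor 8 is the cube of the ratio 2 by which the root may shrink. *)
Lemma osc2_bounds (x : R) :
  x <= arc_end ->
  2 * h * p / s ^ 3 <= osc2 x <= 8 * (2 * h * p / s ^ 3).
Proof using s_pos p_pos h_pos.
intros hx.
assert (hhp : 0 < 2 * h * p) by (repeat apply Rmult_lt_0_compat; lra).
assert (hs3 : 0 < s ^ 3) by (apply pow_lt; lra).
assert (0 < 2 * h * p / s ^ 3) by (apply Rdiv_lt_0_compat; lra).
destruct (Rlt_le_dec x 0) as [xneg | xpos]; unfold osc2.
- rewrite glue_le by lra; unfold arc_left2; lra.
- rewrite glue_ge;
    [ | unfold arc2, arc_left2; rewrite arc_root_0; field; lra | assumption].
  destruct (arc_root_bounds x (conj xpos hx)) as [b1 b2]; unfold arc2.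
  assert (arc_root s p x ^ 3 <= s ^ 3) by (apply pow_incr; lra).
  assert ((s / 2) ^ 3 <= arc_root s p x ^ 3) by (apply pow_incr; lra).
  assert (0 < (s / 2) ^ 3) by (apply pow_lt; lra).
  split.
  + apply Rmult_le_compat_l; [lra | apply Rinv_le_contravar; lra].
  + replace (8 * (2 * h * p / s ^ 3)) with (2 * h * p / (s / 2) ^ 3) by (field; lra).
    apply Rmult_le_compat_l; [lra | apply Rinv_le_contravar; lra].
Qed.

(** At this abscissa the radicand is the square of [s - 2 * p * t], and the bound on [t] says that
    this root is at least [s / 2]. *)
Lemma osc_param (t : R) :
  0 <= t -> t <= s / (4 * p) ->
  0 <= s * t - p * t ^ 2 <= arc_end /\
  osc (s * t - p * t ^ 2) = al * (s * t - p * t ^ 2) + h * t.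
Proof using s_pos p_pos.
intros t0 ht.
assert (hpt : p * t <= s / 4).
{ apply (Rmult_le_compat_l p) in ht; [ | lra].
  replace (p * (s / (4 * p))) with (s / 4) in ht by (field; lra); lra. }
assert (hx0 : 0 <= s * t - p * t ^ 2).
{ replace (s * t - p * t ^ 2) with (t * (s - p * t)) by ring.
  apply Rmult_le_pos; lra. }
split; [split; [assumption | ] | ].
- apply Rmult_le_reg_l with (16 * p); [lra | ].
  replace (16 * p * arc_end) with (3 * s ^ 2) by (unfold arc_end; field; lra).
  nra.
- unfold osc; rewrite glue_ge;
    [ | unfold arc, arc_left; rewrite arc_root_0; field; lra | assumption].
  f_equal; unfold arc, arc_root.
  replace (s ^ 2 - 4 * p * (s * t - p * t ^ 2)) with ((s - 2 * p * t) ^ 2) by ring.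
  rewrite sqrt_pow2 by lra; field; lra.
Qed.

End Arc.

(** * From slope and second derivative at 0 to the required curve *)

Lemma osculating_curve (s p h al w r l : R) :
  0 < s -> 0 < p -> 0 < h -> 0 < r -> 0 < l -> l / r <= 1 / 100 ->
  0 < w < 1 -> Rabs (w - al) <= l / (25 * r) ->
  l / (25 * r) < h / s <= l / (20 * r) ->
  2 / (5 * r) <= 2 * h * p / s ^ 3 <= 1 / r ->
  exists x0 (hx0 : x0 < arc_end s p),
    x0 < 0 /\
    let G := graph_curve x0 (arc_end s p) (osc s p h al) hx0 in
    twice_differentiable_curve G /\ radius_of_curvature_in G (r / 16) (16 * r) /\
    curve_length G < l /\ initial_slope G w.
Proof.
intros s_pos p_pos h_pos r_pos l_pos lr hw hwal [m_lo m_hi] [ka_lo ka_hi].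
apply Rabs_le_between in hwal.
assert (e_pos := arc_end_pos s p s_pos p_pos).
(* The extent to the right is expressed by slope and second derivative at 0, the two quantities
   under control. *)
assert (e_eq : arc_end s p = 3 / 8 * ((h / s) / (2 * h * p / s ^ 3)))
  by (unfold arc_end; field; lra).
set (e := arc_end s p) in *.
set (ka := 2 * h * p / s ^ 3) in *; set (m := h / s) in *.
set (lr1 := l / r) in *.
replace (l / (25 * r)) with (lr1 / 25) in * by (unfold lr1; field; lra).
replace (l / (20 * r)) with (lr1 / 20) in * by (unfold lr1; field; lra).
assert (lr1_pos : 0 < lr1) by (apply Rdiv_lt_0_compat; lra).
assert (ir : 0 < / r) by now apply Rinv_0_lt_compat.
replace (2 / (5 * r)) with (2 / 5 * / r) in ka_lo by (field; lra).
replace (1 / r) with (/ r) in ka_hi by (field; lra).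
assert (ka_pos : 0 < ka) by lra.
(* With second derivative at least [2 / (5 * r)], a change [y] of slope takes an abscissa span of at
   most [5 / 2 * r * y]. *)
assert (div_ka : forall y, 0 <= y -> y / ka <= 5 / 2 * r * y).
{ intros y hy; apply Rmult_le_reg_r with ka; [lra | ].
  replace (y / ka * ka) with y by (field; lra).
  apply (Rmult_le_compat_l (5 / 2 * r * y)) in ka_lo;
    [ | apply Rmult_le_pos; [ | assumption]; lra].
  replace (5 / 2 * r * y * (2 / 5 * / r)) with y in ka_lo by (field; lra); lra. }
(* The abscissa where the Taylor parabola has slope [w]. *)
pose (x0 := - ((m - (w - al)) / ka)).
assert (x0_neg : x0 < 0).
{ assert (0 < (m - (w - al)) / ka) by (apply Rdiv_lt_0_compat; lra).
  unfold x0; lra. }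
assert (x0_lo : - x0 <= 5 / 2 * r * (m - (w - al))).
{ unfold x0; rewrite Ropp_involutive; apply div_ka; lra. }
assert (hx0 : x0 < e) by lra.
assert (w_eq : osc1 s p h al x0 = w).
{ unfold osc1; rewrite glue_le by lra; unfold arc_left1; fold ka m.
  unfold x0; field; lra. }
(* The slope exceeds [w] by at most [l / (25 * r) + l / (10 * r)], which is below 1/100. *)
assert (slope_pos : forall x, x0 <= x <= e -> 0 <= osc1 s p h al x <= 101 / 100).
{ intros x hx.
  enough (w <= osc1 s p h al x <= al + 2 * m) by lra.
  apply osc1_bounds; fold m e; try lra.
  intros xneg; rewrite <- w_eq; unfold osc1; rewrite !glue_le by lra.
  unfold arc_left1; fold ka m; nra. }
assert (slope_sq : forall x, x0 <= x <= e -> osc1 s p h al x ^ 2 <= (3 / 2) ^ 2 - 1)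
  by (intros x hx; specialize (slope_pos x hx); nra).
assert (df := twice_derivatives_osc s p h al s_pos p_pos).
assert (eB := arc_end_lt s p s_pos p_pos).
exists x0, hx0; split; [assumption | split; [ | split; [ | split]]].
- now apply (twice_differentiable_graph _ _ _ _ _ _ _ df).
- apply (radius_of_curvature_graph _ _ _ _ _ _ _ df eB (3 / 2)); try lra; auto.
  intros x hx.
  destruct (osc2_bounds s p h s_pos p_pos h_pos x) as [b1 b2]; [apply hx | ].
  fold ka in b1, b2.
  replace ((3 / 2) ^ 3 / (16 * r)) with (27 / 128 * / r) by (field; lra).
  replace (/ (r / 16)) with (16 * / r) by (field; lra).
  lra.
(* Here [e] is at most [3 / 64 * l] and [- x0] at most [9 / 40 * l], where 9/100 = 1/20 + 1/25. *)
- apply Rle_lt_trans with (3 / 2 * (e - x0)).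
  { apply (curve_length_graph _ _ _ _ _ _ _ df eB); [lra | assumption]. }
  assert (m / ka <= 5 / 2 * r * m) by (apply div_ka; lra).
  assert (r * m <= r * (lr1 / 20)) by (apply Rmult_le_compat_l; lra).
  assert (r * (m - (w - al)) <= r * (9 / 100 * lr1)) by (apply Rmult_le_compat_l; lra).
  assert (r * lr1 = l) by (unfold lr1; field; lra).
  lra.
- rewrite <- w_eq.
  now apply (initial_slope_graph _ _ _ _ _ _ _ df).
Qed.

(** * Estimates for the rounded parameters *)

Lemma Rdiv_le_cross (a b c d : R) : 0 < b -> 0 < d -> a * d <= c * b -> a / b <= c / d.
Proof.
intros hb hd h; apply Rmult_le_reg_r with (b * d); [now apply Rmult_lt_0_compat | ].
replace (a / b * (b * d)) with (a * d) by (field; lra).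
replace (c / d * (b * d)) with (c * b) by (field; lra); assumption.
Qed.

Lemma Rdiv_lt_cross (a b c d : R) : 0 < b -> 0 < d -> a * d < c * b -> a / b < c / d.
Proof.
intros hb hd h; apply Rmult_lt_reg_r with (b * d); [now apply Rmult_lt_0_compat | ].
replace (a / b * (b * d)) with (a * d) by (field; lra).
replace (c / d * (b * d)) with (c * b) by (field; lra); assumption.
Qed.

Lemma exists_Z_above (x : R) : exists n : Z, x < IZR n <= x + 1.
Proof. exists (up x); destruct (archimed x); lra. Qed.

(* [K] is the determinant of the direction (q, a) with the chord to the next
   lattice point, and [- 2 E (q, a)] is the constant second difference of the
   lattice points. Prescribing the slope [l / (20 r)] and the second derivative
   [1 / (2 r)] at 0 determines the ideal values [20 K r / (Q l)] of [s] and
   [20 ^ 3 K ^ 2 r ^ 2 / (4 (Q l) ^ 3)] of [E]. Rounding them to the admissible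
   ones is harmless because the latter is at least 1, which is where
   [Q l < M r ^ (2 / 3)] is used. *)
Lemma arc_parameters (M z l Q K E s : R) :
  800 < M -> 0 < z -> M ^ 2 * z < l -> 1 <= Q -> Q * l < M * z ^ 2 ->
  M ^ 2 < K <= M ^ 2 + 1 ->
  2000 * K ^ 2 * (z ^ 3) ^ 2 / (Q * l) ^ 3 < E
    <= 2000 * K ^ 2 * (z ^ 3) ^ 2 / (Q * l) ^ 3 + 1 ->
  20 * K * z ^ 3 / (Q * l) < s <= 20 * K * z ^ 3 / (Q * l) + Q ->
  (0 < s /\ 0 < E) /\
  l / (25 * z ^ 3) < K / Q / s <= l / (20 * z ^ 3) /\
  2 / (5 * z ^ 3) <= 2 * (K / Q) * (E * Q) / s ^ 3 <= 1 / z ^ 3 /\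
  Q * l ^ 2 / (M ^ 6 * z ^ 3) <= s / (4 * (E * Q)).
Proof.
intros hM hz hl hQ hQl hK.
assert (hM2 : 640000 < M ^ 2) by nra.
assert (l_pos : 0 < l) by nra.
assert (r_pos : 0 < z ^ 3) by now apply pow_lt.
assert (A_pos : 0 < Q * l) by (apply Rmult_lt_0_compat; lra).
(* Comparing [M ^ 2 * z < l] with [Q * l < M * z ^ 2] gives [Q * M < z]. The bound makes the
   rounding error [Q] of [s] small. *)
assert (hQA : Q * (Q * l) <= z ^ 3).
{ assert (hQM : Q * M < z).
  { apply Rmult_lt_reg_r with (M * z); [apply Rmult_lt_0_compat; lra | ].
    apply Rlt_trans with (Q * l); [ | lra].
    replace (Q * M * (M * z)) with (Q * (M ^ 2 * z)) by ring.
    apply Rmult_lt_compat_l; lra. }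
  apply Rle_trans with (Q * (M * z ^ 2)); [apply Rmult_le_compat_l; lra | ].
  replace (Q * (M * z ^ 2)) with (Q * M * z ^ 2) by ring.
  replace (z ^ 3) with (z * z ^ 2) by ring.
  apply Rmult_le_compat_r; [apply pow2_ge_0 | lra]. }
assert (hA3 : (Q * l) ^ 3 <= M ^ 3 * (z ^ 3) ^ 2).
{ replace (M ^ 3 * (z ^ 3) ^ 2) with ((M * z ^ 2) ^ 3) by ring.
  apply pow_incr; lra. }
assert (hMK : M ^ 3 <= 2000 * K ^ 2).
{ assert (M ^ 3 <= (M ^ 2) ^ 2).
  { rewrite <- pow_mult; apply Rle_pow; [lra | lia]. }
  assert ((M ^ 2) ^ 2 <= K ^ 2) by (apply pow_incr; lra).
  assert (0 <= K ^ 2) by apply pow2_ge_0; lra. }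
assert (hKM6 : 800 * K <= M ^ 6).
{ replace (M ^ 6) with ((M ^ 2) ^ 3) by ring.
  generalize dependent (M ^ 2); intros m **.
  assert (640000 * m <= m ^ 2) by nra.
  assert (m ^ 2 <= m ^ 3) by (apply Rle_pow; [lra | lia]); lra. }
set (A := Q * l) in *; set (r := z ^ 3) in *.
(* [S] is the ideal value of [s], and [S ^ 3 / (4 * (K * r))] that of [E]. *)
set (S := 20 * K * r / A).
assert (A3_pos : 0 < A ^ 3) by now apply pow_lt.
assert (K_pos : 0 < K) by lra.
assert (Kr_pos : 0 < K * r) by now apply Rmult_lt_0_compat.
assert (S_pos : 0 < S) by (apply Rdiv_lt_0_compat; lra).
assert (S3_pos : 0 < S ^ 3) by now apply pow_lt.
replace (2000 * K ^ 2 * r ^ 2 / A ^ 3) with (S ^ 3 / (4 * (K * r)))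
  by (unfold S; field; lra).
assert (e_ge1 : 1 <= S ^ 3 / (4 * (K * r))).
{ replace (S ^ 3 / (4 * (K * r))) with (2000 * K ^ 2 * r ^ 2 / A ^ 3)
    by (unfold S; field; lra).
  apply Rmult_le_reg_r with (A ^ 3); [assumption | ].
  replace (2000 * K ^ 2 * r ^ 2 / A ^ 3 * A ^ 3) with (2000 * K ^ 2 * r ^ 2)
    by (field; lra).
  assert (M ^ 3 * r ^ 2 <= 2000 * K ^ 2 * r ^ 2)
    by (apply Rmult_le_compat_r; [apply pow2_ge_0 | assumption]); lra. }
intros [E_lo E_hi] [s_lo s_hi].
assert (KrE_lo : S ^ 3 <= 4 * (K * r) * E).
{ apply Rlt_le, (Rmult_le_compat_l (4 * (K * r))) in E_lo; [ | lra].
  now replace (4 * (K * r) * (S ^ 3 / (4 * (K * r)))) with (S ^ 3) in E_lo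
    by (field; lra). }
(* The ideal value is at least 1, so rounding up at most doubles it. *)
assert (KrE_hi : 4 * (K * r) * E <= 2 * S ^ 3).
{ assert (E_hi2 : E <= 2 * (S ^ 3 / (4 * (K * r)))) by lra.
  apply (Rmult_le_compat_l (4 * (K * r))) in E_hi2; [ | lra].
  now replace (4 * (K * r) * (2 * (S ^ 3 / (4 * (K * r))))) with (2 * S ^ 3) in E_hi2
    by (field; lra). }
assert (E_pos : 0 < E) by lra.
assert (hQS : Q <= S / 20).
{ apply Rmult_le_reg_r with A; [assumption | ].
  replace (S / 20 * A) with (K * r) by (unfold S; field; lra).
  apply Rle_trans with (1 := hQA); nra. }
assert (s_pos : 0 < s) by lra.
assert (s3_pos : 0 < s ^ 3) by now apply pow_lt.
assert (s3_lo : S ^ 3 <= s ^ 3) by (apply pow_incr; lra).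
assert (s3_hi : s ^ 3 <= (21 / 20 * S) ^ 3) by (apply pow_incr; lra).
assert (EQ_pos : 0 < E * Q) by (apply Rmult_lt_0_compat; lra).
assert (SA : S * A = 20 * (K * r)) by (unfold S; field; lra).
replace (K / Q / s) with (K / (Q * s)) by (field; lra).
replace (2 * (K / Q) * (E * Q) / s ^ 3) with (2 * (K * E) / s ^ 3) by (field; lra).
assert (Qs_pos : 0 < Q * s) by (apply Rmult_lt_0_compat; lra).
assert (lQs : l * (Q * s) = s * A) by (unfold A; ring).
repeat split; try assumption.
- apply Rdiv_lt_cross; [lra | lra | ]; rewrite lQs.
  assert (s * A <= 21 / 20 * S * A) by (apply Rmult_le_compat_r; lra); nra.
- apply Rdiv_le_cross; [lra | lra | ]; rewrite lQs.
  assert (S * A <= s * A) by (apply Rmult_le_compat_r; lra); lra.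
(* As [s] is at most [21 / 20 * S], the lower constant is (20/21)^3 / 2, which exceeds 2/5. *)
- apply Rdiv_le_cross; [lra | lra | ]; lra.
- apply Rdiv_le_cross; [lra | lra | ]; lra.
(* The number 800 is 2 times 20^2: one 2 from the rounding of [E], the square from
   [S * A = 20 * (K * r)]. *)
- apply Rle_trans with (Q * l ^ 2 / (800 * K * r)).
  { apply Rmult_le_compat_l; [apply Rmult_le_pos; [lra | apply pow2_ge_0] | ].
    apply Rinv_le_contravar; [nra | ].
    apply Rmult_le_compat_r; lra. }
  apply Rdiv_le_cross; [nra | lra | ].
  replace (Q * l ^ 2 * (4 * (E * Q))) with (4 * A ^ 2 * E) by (unfold A; ring).
  apply Rmult_le_reg_l with (K * r); [assumption | ].
  replace (K * r * (4 * A ^ 2 * E)) with (A ^ 2 * (4 * (K * r) * E)) by ring.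
  apply Rle_trans with (A ^ 2 * (2 * S ^ 3)).
  { apply Rmult_le_compat_l; [apply pow2_ge_0 | assumption]. }
  replace (A ^ 2 * (2 * S ^ 3)) with (2 * S * (S * A) ^ 2) by ring.
  rewrite SA.
  replace (2 * S * (20 * (K * r)) ^ 2) with (800 * (K * r) ^ 2 * S) by ring.
  replace (K * r * (s * (800 * K * r))) with (800 * (K * r) ^ 2 * s) by ring.
  apply Rmult_le_compat_l; [ | lra].
  apply Rmult_le_pos; [lra | apply pow2_ge_0].
Qed.

(** * The powers of [r] with exponents 1/3 and 2/3 *)

Lemma Rpower_third_cube (r : R) : 0 < r -> Rpower r (1 / 3) ^ 3 = r.
Proof.
intros hr; rewrite <- Rpower_pow by apply exp_pos.
rewrite Rpower_mult; replace (1 / 3 * INR 3) with 1 by (simpl; field).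
now apply Rpower_1.
Qed.

Lemma Rpower_two_thirds (r : R) : Rpower r (2 / 3) = Rpower r (1 / 3) ^ 2.
Proof.
rewrite <- Rpower_pow by apply exp_pos.
rewrite Rpower_mult; f_equal; simpl; field.
Qed.

(** * Lattice points on the parabola *)

Lemma exists_det (a q k : Z) :
  Z.gcd a q = 1%Z -> exists b d : Z, (q * d - a * b)%Z = k.
Proof.
intros h; destruct (Z.gcd_bezout a q 1 h) as [u [v huv]].
exists (- u * k)%Z, (v * k)%Z; rewrite <- (Z.mul_1_l k) at 3; rewrite <- huv; ring.
Qed.

(** The point of index [n] is the one of parameter [t = n]: with [s = b + e q] its abscissa is
    [s n - e q n^2], and it lies on the line [q y - a x = k n], where [k = q d - a b]. *)
Lemma lattice_points_osc (a q b d e : Z) (s : R) (x0 : R)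
  (hx0 : x0 < arc_end s (IZR e * IZR q)) (j : nat) :
  (0 < q)%Z -> (0 < e)%Z -> (0 < q * d - a * b)%Z -> s = IZR (b + e * q) -> 0 < s ->
  x0 < 0 -> INR j <= s / (4 * (IZR e * IZR q)) ->
  let n := Z.of_nat j in
  lattice_points_on
    (graph_curve x0 (arc_end s (IZR e * IZR q))
       (osc s (IZR e * IZR q) (IZR (q * d - a * b) / IZR q) (IZR a / IZR q)) hx0)
    ((b * n - e * q * n * (n - 1))%Z, (d * n - e * a * n * (n - 1))%Z).
Proof.
intros q_pos e_pos k_pos hs s_pos hx0_neg hj n.
apply IZR_lt in q_pos; apply IZR_lt in e_pos.
assert (p_pos : 0 < IZR e * IZR q) by now apply Rmult_lt_0_compat.
apply lattice_points_on_graph.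
destruct (osc_param s (IZR e * IZR q) (IZR (q * d - a * b) / IZR q) (IZR a / IZR q)
  s_pos p_pos (INR j) (pos_INR j) hj) as [h1 h2].
assert (hx : IZR (b * n - e * q * n * (n - 1))
  = s * INR j - IZR e * IZR q * INR j ^ 2).
{ rewrite hs, INR_IZR_INZ; fold n.
  rewrite !minus_IZR, !plus_IZR, !mult_IZR, minus_IZR; ring. }
rewrite hx; split; [lra | ].
rewrite h2, <- hx, INR_IZR_INZ; fold n.
rewrite !minus_IZR, !mult_IZR, minus_IZR; field; lra.
Qed.

(** The form [q y - a x] takes the value [(q d - a b) n] at the point of index [n], hence recovers
    [n]. *)
Lemma injective_lattice_points (a q b d e : Z) :
  (q * d - a * b <> 0)%Z ->
  Injective (fun j => let n := Z.of_nat j in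
    ((b * n - e * q * n * (n - 1))%Z, (d * n - e * a * n * (n - 1))%Z)).
Proof.
intros hk i j h; injection h as h1 h2.
apply Nat2Z.inj, (Z.mul_reg_l _ _ _ hk).
set (m := Z.of_nat i) in *; set (n := Z.of_nat j) in *.
replace ((q * d - a * b) * m)%Z with
  (q * (d * m - e * a * m * (m - 1)) - a * (b * m - e * q * m * (m - 1)))%Z by ring.
rewrite h1, h2; ring.
Qed.

(** * Choice of the integers and final count *)

Theorem mainTheorem11 (C r l w : R) (a q : Z)
  (hC : 1 < C) (hr : 1 < r) (hl : 1 < l)
  (hl_lower : (800 * C ^ 4) ^ 2 * Rpower r (1 / 3) < l)
  (hl_upper : l < Rpower r (2 / 3))
  (hw : 0 < w < 1)
  (haq : Z.gcd a q = 1%Z)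
  (hq1 : (1 <= q)%Z)
  (hq2 : IZR q < 800 * C ^ 4 * Rpower r (2 / 3) / l)
  (hwaq : Rabs (w - IZR a / IZR q) <= l / (25 * r)) :
  exists G : plane_curve,
    (twice_differentiable_curve G /\ radius_of_curvature_in G (r / 16) (16 * r)) /\
    curve_length G < l /\
    initial_slope G w /\
    exists N : nat,
      has_cardinal (lattice_points_on G) N /\
      INR N >= 1 / 4 + 1 / 4 * (1 / (800 * C ^ 4) ^ 6) * (IZR q * l ^ 2 / r).
Proof.
assert (hM : 800 < 800 * C ^ 4).
{ assert (1 < C ^ 4) by (apply Rlt_pow_R1; [lra | lia]); lra. }
set (M := 800 * C ^ 4) in *.
rewrite Rpower_two_thirds in hl_upper, hq2.
assert (hz3 : Rpower r (1 / 3) ^ 3 = r) by (apply Rpower_third_cube; lra).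
assert (z_pos : 0 < Rpower r (1 / 3)) by apply exp_pos.
set (z := Rpower r (1 / 3)) in *.
assert (Q1 : 1 <= IZR q) by now apply IZR_le.
assert (hQl : IZR q * l < M * z ^ 2).
{ apply (Rmult_lt_compat_r l) in hq2; [ | lra].
  now replace (M * z ^ 2 / l * l) with (M * z ^ 2) in hq2 by (field; lra). }
destruct (exists_Z_above (M ^ 2)) as [k hk].
destruct (exists_Z_above (2000 * IZR k ^ 2 * (z ^ 3) ^ 2 / (IZR q * l) ^ 3)) as [e he].
assert (k_pos : (0 < k)%Z).
{ apply lt_IZR; apply Rlt_trans with (M ^ 2); [apply pow_lt; lra | apply hk]. }
assert (hs : exists b d : Z, (q * d - a * b)%Z = k /\
  20 * IZR k * z ^ 3 / (IZR q * l) < IZR (b + e * q)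
    <= 20 * IZR k * z ^ 3 / (IZR q * l) + IZR q).
(* Adding [n] times (q, a) to (b, d) keeps the determinant and shifts [b + e * q] by [n * q], so the
   latter can be put in any half-open interval of length [q]. *)
{ set (S := 20 * IZR k * z ^ 3 / (IZR q * l)).
  destruct (exists_det a q k haq) as [b0 [d0 hbd]].
  destruct (exists_Z_above ((S - IZR (b0 + e * q)) / IZR q)) as [n [n1 n2]].
  exists (b0 + n * q)%Z, (d0 + n * a)%Z; split; [rewrite <- hbd; ring | ].
  replace (b0 + n * q + e * q)%Z with (b0 + e * q + n * q)%Z by ring.
  rewrite plus_IZR, mult_IZR; set (c := IZR (b0 + e * q)) in *.
  apply (Rmult_lt_compat_r (IZR q)) in n1; [ | lra].
  apply (Rmult_le_compat_r (IZR q)) in n2; [ | lra].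
  replace (((S - c) / IZR q + 1) * IZR q) with (S - c + IZR q) in n2 by (field; lra).
  replace ((S - c) / IZR q * IZR q) with (S - c) in n1 by (field; lra).
  lra. }
destruct hs as [b [d [hbd hs]]].
destruct (arc_parameters M z l (IZR q) (IZR k) (IZR e) (IZR (b + e * q)))
  as [[s_pos E_pos] [h_slope [h_curv h_count]]]; try assumption.
rewrite hz3 in h_slope, h_curv, h_count.
remember (IZR (b + e * q)) as s eqn:s_def.
assert (e_pos : (0 < e)%Z) by now apply lt_IZR.
assert (p_pos : 0 < IZR e * IZR q) by (apply Rmult_lt_0_compat; lra).
assert (h_pos : 0 < IZR k / IZR q).
{ apply Rdiv_lt_0_compat; [now apply IZR_lt | lra]. }
(* From [M ^ 2 * z < l < z ^ 2] follows [M ^ 2 < z], while [l / r] is below [1 / z]. *)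
assert (hlr : l / r <= 1 / 100).
{ replace (l / r) with (l / z ^ 3) by now rewrite hz3.
  apply Rdiv_le_cross; [now apply pow_lt | lra | ].
  assert (M ^ 2 < z) by (apply Rmult_lt_reg_r with z; lra).
  assert (800 < M ^ 2) by nra.
  assert (100 * z ^ 2 <= z * z ^ 2)
    by (apply Rmult_le_compat_r; [apply pow2_ge_0 | lra]).
  replace (z ^ 3) with (z * z ^ 2) by ring; lra. }
destruct (osculating_curve s (IZR e * IZR q) (IZR k / IZR q) (IZR a / IZR q) w r l)
  as [x0 [hx0 [x0_neg [tdiff [curv [len slope]]]]]]; try assumption; try lra.
eexists; split; [split; [exact tdiff | exact curv] | ].
split; [exact len | split; [exact slope | ]].
destruct (lattice_points_on_graph_finite x0 (arc_end s (IZR e * IZR q))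
  (osc s (IZR e * IZR q) (IZR k / IZR q) (IZR a / IZR q)) hx0) as [N hN].
exists N; split; [exact hN | ].
set (Y := s / (4 * (IZR e * IZR q))) in *.
assert (Y_pos : 0 < Y) by (apply Rdiv_lt_0_compat; lra).
destruct (nfloor_ex Y) as [J [J1 J2]]; [lra | ].
(* The indices run from 0 to the integer part [J] of [Y], which makes [J + 1] points. *)
assert (hJN : (S J <= N)%nat).
{ refine (has_cardinal_ge _ _ _ _ _ (injective_lattice_points a q b d e _) _ hN); [lia | ].
  intros j hj; subst k; apply lattice_points_osc; try assumption; try lia.
  apply Rle_trans with (INR J); [apply le_INR; lia | assumption]. }
apply le_INR in hJN; rewrite S_INR in hJN.
assert (0 <= INR J) by apply pos_INR.
replace (1 / 4 * (1 / M ^ 6) * (IZR q * l ^ 2 / r))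
  with (1 / 4 * (IZR q * l ^ 2 / (M ^ 6 * r))) by (field; lra).
(* The count is at least [J + 1], which is at least 1 and exceeds [Y], hence is at least
   [1 / 4 + 1 / 4 * Y]. *)
lra.
Qed.
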